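(* Let $j\ge 3$ and let $\alpha=\alpha_1\cdots\alpha_j$ and $\beta=\beta_1\cdots\beta_j$ be permutations in $S_j$ which are mutually minimal overlapping, and suppose there is $1\le a<j$ such that $\alpha_i=\beta_i$ for all $i\le a$, $\alpha_a=\beta_a=1$, $\alpha_j=\beta_j$, and $\mathrm{des}(\alpha)=\mathrm{des}(\beta)$. Then \[ \sum_{n\ge 0}\frac{t^n}{n!}\sum_{\sigma\in\mathcal{NM}_n(\alpha)} z^{\mathrm{des}(\sigma)}u^{\mathrm{LRmin}(\sigma)}=\sum_{n\ge 0}\frac{t^n}{n!}\sum_{\sigma\in\mathcal{NM}_n(\beta)} z^{\mathrm{des}(\sigma)}u^{\mathrm{LRmin}(\sigma)}, \] so $\alpha$ and $\beta$ are $(\mathrm{des},\mathrm{LRmin})$-c-Wilf equivalent. If in addition $\mathrm{inv}(\alpha)=\mathrm{inv}(\beta)$, then \[ \sum_{n\ge 0}\frac{t^n}{[n]_q!}\sum_{\sigma\in\mathcal{NM}_n(\alpha)} x^{\mathrm{des}(\sigma)}q^{\mathrm{inv}(\sigma)}u^{\mathrm{LRmin}(\sigma)}=\sum_{n\ge 0}\frac{t^n}{[n]_q!}\sum_{\sigma\in\mathcal{NM}_n(\beta)} x^{\mathrm{des}(\sigma)}q^{\mathrm{inv}(\sigma)}u^{\mathrm{LRmin}(\sigma)}, \] so $\alpha$ and $\beta$ are $(\mathrm{des},\mathrm{inv},\mathrm{LRmin})$-c-Wilf equivalent.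
   Context: $S_n$ is the set of permutations $\sigma=\sigma_1\cdots\sigma_n$ of $\{1,\dots,n\}$. $\mathrm{des}(\sigma)=|\{i:\sigma_i>\sigma_{i+1}\}|$, $\mathrm{inv}(\sigma)=|\{(i,k):i<k,\ \sigma_i>\sigma_k\}|$, and $\mathrm{LRmin}(\sigma)$ is the number of left-to-right minima of $\sigma$, i.e. of entries $\sigma_k$ with $\sigma_i>\sigma_k$ for all $i<k$. For a sequence $w$ of distinct positive integers, $\mathrm{red}(w)$ replaces the $i$-th smallest entry by $i$. For $\tau\in S_j$, $\sigma\in S_n$ has a $\tau$-match starting at position $i$ if $\mathrm{red}(\sigma_i\cdots\sigma_{i+j-1})=\tau$; $\tau\text{-}\mathrm{mch}(\sigma)$ is the number of $\tau$-matches, and $\mathcal{NM}_n(\tau)$ is the set of $\sigma\in S_n$ with no $\tau$-match. $\tau\in S_j$ ($j\ge3$) is minimal overlapping if the smallest $i$ such that some $\sigma\in S_i$ has $\tau\text{-}\mathrm{mch}(\sigma)=2$ is $2j-1$. Two permutations $\alpha,\beta\in S_j$ are mutually minimal overlapping if both are minimal overlapping and the smallest $n$ such that some $\sigma\in S_n$ has $\alpha\text{-}\mathrm{mch}(\sigma)\ge1$ and $\beta\text{-}\mathrm{mch}(\sigma)\ge1$ is $2j-1$. $[n]_q=1+q+\cdots+q^{n-1}$, $[n]_q!=[1]_q\cdots[n]_q$, $[0]_q!=1$. *)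

(* Defs.v *)
From HB Require Import structures.
From mathcomp Require Import all_boot all_order all_algebra all_fingroup.
From mathcomp Require Import mpoly.

Set Implicit Arguments.
Unset Strict Implicit.
Unset Printing Implicit Defensive.

Import GRing.Theory.

(* Permutations of {1, ..., n} are elements of 'S_n = {perm 'I_n}, with both
   positions and values shifted down by one: the first entry of s is s 0, and
   the smallest value 1 becomes the ordinal 0. *)

Definition one_line n (s : 'S_n) : seq nat := [seq val (s i) | i <- enum 'I_n].

Definition des n (s : 'S_n) : nat :=
  #|[set i : 'I_n | [exists k : 'I_n, (k == i.+1 :> nat) && (s k < s i)]]|.

Definition ninv n (s : 'S_n) : nat :=
  #|[set p : 'I_n * 'I_n | (p.1 < p.2) && (s p.2 < s p.1)]|.

Definition LRmin n (s : 'S_n) : nat :=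
  #|[set k : 'I_n | [forall i : 'I_n, (i < k) ==> (s k < s i)]]|.

(* Values are 0-based, so the smallest entry of w is replaced by 0. *)
Definition red (w : seq nat) : seq nat := [seq index x (sort leq w) | x <- w].

(* A window that would run past the end of s is truncated by [take], has length
   < j, and hence never reduces to tau. *)
Definition matches_at j (tau : 'S_j) n (s : 'S_n) (i : nat) : bool :=
  red (take j (drop i (one_line s))) == one_line tau.

Definition mch j (tau : 'S_j) n (s : 'S_n) : nat :=
  #|[set i : 'I_n | matches_at tau s i]|.

Definition NM n j (tau : 'S_j) : {set 'S_n} := [set s | mch tau s == 0].

Definition is_smallest (P : nat -> Prop) (m : nat) : Prop :=
  P m /\ forall n, P n -> m <= n.

Definition minimal_overlapping j (tau : 'S_j) : Prop :=
  is_smallest (fun n => exists s : 'S_n, mch tau s = 2) (2 * j - 1).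

Definition mutually_minimal_overlapping j (alpha beta : 'S_j) : Prop :=
  [/\ minimal_overlapping alpha,
      minimal_overlapping beta &
      is_smallest
        (fun n => exists s : 'S_n, 1 <= mch alpha s /\ 1 <= mch beta s)
        (2 * j - 1)].

Definition perm_stat := forall n, 'S_n -> nat.

Local Open Scope ring_scope.

Definition c_Wilf_equivalent k (st : k.-tuple perm_stat) j
    (alpha beta : 'S_j) : Prop :=
  forall n,
    \sum_(s in NM n alpha) \prod_(i < k) 'X_i ^+ tnth st i n s =
    \sum_(s in NM n beta) \prod_(i < k) 'X_i ^+ tnth st i n s
      :> {mpoly rat[k]}.

(* A formal power series in t is given by its sequence of coefficients;
   equality of series is then pointwise equality [=1]. *)
Definition series_in_t (R : Type) : Type := nat -> R.

Definition qnat (R : pzSemiRingType) (q : R) (n : nat) : R :=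
  \sum_(i < n) q ^+ i.

Definition qfact (R : pzSemiRingType) (q : R) (n : nat) : R :=
  \prod_(1 <= i < n.+1) qnat q i.

Definition egf_des_LRmin j (tau : 'S_j) : series_in_t {mpoly rat[2]} :=
  let z := 'X_0 in let u := 'X_1 in
  fun n => (n`!%:R)^-1 *: \sum_(s in NM n tau) z ^+ des s * u ^+ LRmin s.

(* As [n]_q! is to be inverted with q an
   indeterminate, the coefficients are taken in Q(x, q, u). *)
Definition qegf_des_inv_LRmin j (tau : 'S_j) :
    series_in_t {fraction {mpoly rat[3]}} :=
  let x := 'X_0 in let q := 'X_1 in let u := 'X_2 in
  fun n =>
    tofrac (\sum_(s in NM n tau) x ^+ des s * q ^+ ninv s * u ^+ LRmin s)
      / tofrac (qfact q n).

(* Main.v *)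
Require Import Defs.
From HB Require Import structures.
From mathcomp Require Import all_boot all_order all_algebra all_fingroup.
From mathcomp Require Import mpoly.
From mathcomp Require Import zify.

Set Implicit Arguments.
Unset Strict Implicit.
Unset Printing Implicit Defensive.

(** Two matches of alpha or beta share at most one position, which is then an
    end of both windows. Since alpha and beta agree at both ends, rearranging a
    window that matches alpha into one that matches beta (or conversely) affects
    no other match. It preserves des; it preserves inv if alpha and beta have
    the same inv, because the set of values in the window does not change; and
    it preserves the left-to-right minima, because the entries up to the minimum
    of the window do not move and the later ones in the window are never
    left-to-right minima. Doing this at every position in turn gives a bijection
    that exchanges the alpha-matches and the beta-matches. *)

(** * Reduction of words and order isomorphism *)

Lemma index_sorted (t : seq nat) (x : nat) :
  sorted leq t -> x \in t -> index x t = count (ltn^~ x) t.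
Proof.
elim: t => //= y t IH st; rewrite inE eq_sym.
have st' := path_sorted st.
have /allP le_t := order_path_min leq_trans st.
case: eqVneq => [<- _|neq /= xt].
  rewrite ltnn; apply/esym/eqP; rewrite -leqn0 leqNgt -has_count.
  by apply/hasPn => z /le_t; rewrite /= -leqNgt.
by rewrite IH // ltn_neqAle neq le_t.
Qed.

(** Counting positions rather than values keeps this equal to the index in the sorted list even when
    [f] repeats a value. *)
Definition rank m (f : 'I_m -> nat) (k : 'I_m) : nat := #|[set l | f l < f k]|.

Lemma red_map m (f : 'I_m -> nat) :
  red [seq f k | k <- enum 'I_m] = [seq rank f k | k <- enum 'I_m].
Proof.
rewrite /red -map_comp; apply/eq_in_map => k _ /=.
rewrite index_sorted ?(sort_sorted leq_total) //; last first.
  by rewrite mem_sort map_f // mem_enum.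
rewrite (seq.permP (permEl (perm_sort leq _))) count_map /rank -sum1dep_card.
by rewrite -sum1_count big_enum_cond.
Qed.

Lemma ltn_rank m (f : 'I_m -> nat) k l : (rank f k < rank f l) = (f k < f l).
Proof.
have mono x y : f x <= f y -> rank f x <= rank f y.
  move=> le; apply/subset_leq_card/subsetP => z; rewrite !inE => lt.
  exact: leq_trans le.
case: (leqP (f l) (f k)) => [/mono|lt]; first by rewrite leqNgt => /negbTE.
apply/proper_card/properP; split; last by exists k; rewrite !inE ?ltnn.
(* The inclusion is strict because [k] counts for [l] but not for itself. *)
by apply/subsetP => z; rewrite !inE => lt'; apply: ltn_trans lt.
Qed.

Lemma rank_perm m (tau : 'S_m) k : rank (fun l => tau l) k = tau k.
Proof.
(* The set counted is the preimage under [tau] of an initial segment of length [tau k]. *)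
have -> : rank (fun l => tau l) k = #|tau @^-1: [set l : 'I_m | l < tau k]|.
  by congr #|pred_of_set _|; apply/setP => l; rewrite !inE.
rewrite card_preimset; last exact: perm_inj.
rewrite -sum1dep_card -(big_ord_widen_cond _ predT (fun=> 1)) ?sum1_card ?card_ord //.
exact: ltnW.
Qed.

Definition order_iso m (f g : 'I_m -> nat) :=
  [forall k, forall l, (f k < f l) == (g k < g l)].

Lemma order_isoP m (f g : 'I_m -> nat) :
  reflect (forall k l, (f k < f l) = (g k < g l)) (order_iso f g).
Proof.
apply: (iffP forallP) => [H k l|H k]; last by apply/forallP => l; rewrite H.
by have /forallP/(_ l)/eqP := H k.
Qed.

(** Ranks depend only on the relative order of the values, and a permutation is its own rank
    function. Matches can thus be handled by comparing entries, without lists. *)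
Lemma red_eq_one_line m (f : 'I_m -> nat) (tau : 'S_m) :
  (red [seq f k | k <- enum 'I_m] == one_line tau) = order_iso f (fun k => tau k).
Proof.
rewrite red_map; apply/eqP/order_isoP => [H k l|H].
  have E x : rank f x = tau x.
    by have /eq_in_map := H; apply; rewrite mem_enum.
  by rewrite -!E ltn_rank.
apply: eq_map => k; rewrite -[RHS]rank_perm.
by congr #|pred_of_set _|; apply/setP => l; rewrite !inE H.
Qed.

Lemma standardization m (f : 'I_m -> nat) :
  injective f -> exists rho : 'S_m, order_iso f (fun k => rho k).
Proof.
move=> injf.
have rk k : rank f k < m.
  rewrite -[X in _ < X]card_ord; apply: proper_card; apply/properP.
  by split; [exact/subsetP|exists k; rewrite ?inE ?ltnn].
have inj : injective (fun k => Ordinal (rk k)).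
  move=> k l [] E; apply: injf; apply/eqP; rewrite eqn_leq leqNgt [X in _ && X]leqNgt.
  by rewrite -(ltn_rank f k l) -(ltn_rank f l k) E ltnn.
by exists (perm inj); apply/order_isoP => k l; rewrite !permE /= ltn_rank.
Qed.

(** * Windows of a permutation and their matches *)

Definition window n i m (H : i + m <= n) (k : 'I_m) : 'I_n :=
  Ordinal (leq_trans (eq_leq (esym (addnS i k)))
                     (leq_trans (leq_add (leqnn i) (ltn_ord k)) H)).

Lemma window_inj n i m (H : i + m <= n) : injective (window H).
Proof. by move=> k l [] /addnI /val_inj. Qed.
Arguments window_inj {n i m} H [x1 x2].

Lemma size_one_line n (s : 'S_n) : size (one_line s) = n.
Proof. by rewrite size_map size_enum_ord. Qed.

Lemma matches_at_window n i m (H : i + m <= n) (tau : 'S_m) (s : 'S_n) :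
  matches_at tau s i = order_iso (fun k => s (window H k)) (fun k => tau k).
Proof.
rewrite -red_eq_one_line /matches_at; congr (red _ == _).
have sz : size (take m (drop i (one_line s))) = m.
  by rewrite size_take_min size_drop size_one_line; lia.
apply: (@eq_from_nth _ 0) => [|k]; first by rewrite sz size_map size_enum_ord.
rewrite sz => km; rewrite nth_take // nth_drop.
rewrite (nth_map (Ordinal km)) ?size_enum_ord //.
have ikn : i + k < n by apply: leq_trans H; rewrite ltn_add2l.
rewrite (nth_map (Ordinal ikn)) ?size_enum_ord //.
by congr (val (s _)); apply/val_inj; rewrite /= !nth_enum_ord.
Qed.

(** A truncated window is too short to reduce to [tau]. For [m = 0] the empty pattern matches at
    every [i], even beyond [n]. *)
Lemma matches_at_bound n i m (tau : 'S_m) (s : 'S_n) :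
  0 < m -> matches_at tau s i -> i + m <= n.
Proof.
move=> m0 /eqP/(congr1 size).
rewrite size_map size_take_min size_drop !size_one_line.
lia.
Qed.

(** Standardizing a factor of [s] gives a shorter permutation with the same matches, to which the
    minimality hypotheses apply. *)
Lemma subpattern n i m (s : 'S_n) : i + m <= n ->
  exists rho : 'S_m, forall j (tau : 'S_j) p, p + j <= m ->
    matches_at tau rho p = matches_at tau s (i + p).
Proof.
move=> H.
have inj : injective (fun k => s (window H k) : nat).
  by move=> k l /val_inj/perm_inj/window_inj.
have [rho /order_isoP iso] := standardization inj.
exists rho => j tau p Hp.
have Hip : i + p + j <= n by lia.
rewrite (matches_at_window Hp) (matches_at_window Hip).
have E k : s (window Hip k) = s (window H (window Hp k)).
  by congr (s _); apply/val_inj; rewrite /= addnA.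
by apply: eq_forallb => k; apply: eq_forallb => l; rewrite !E iso.
Qed.

(** * Distance between matches *)

Lemma mch_gt0 n j (tau : 'S_j) (s : 'S_n) i :
  0 < j -> matches_at tau s i -> 0 < mch tau s.
Proof.
move=> j0 M; have := matches_at_bound j0 M => H.
have lt : i < n by lia.
by apply/card_gt0P; exists (Ordinal lt); rewrite inE.
Qed.

(** If two matches at distance d are the only ones in a permutation of length d + j, minimality
    gives d + j >= 2j - 1, so the windows share at most one position. *)
Lemma minimal_overlapping_sep n j (tau : 'S_j) (s : 'S_n) i k :
  0 < j -> minimal_overlapping tau ->
  matches_at tau s i -> matches_at tau s k -> i < k -> i + j.-1 <= k.
Proof.
move=> j0 [_ mini] Mi Mk lt.
(* Cutting at the first match after i leaves exactly two matches. *)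
have exk : exists k, (i < k) && matches_at tau s k by exists k; rewrite lt.
case: (ex_minnP exk) => k1 /andP[lt1 Mk1] min1.
have lek1 : k1 <= k by apply: min1; rewrite lt.
apply: leq_trans lek1.
have H : i + (k1 - i + j) <= n by have := matches_at_bound j0 Mk1; lia.
have [rho E] := subpattern s H.
suff : 2 * j - 1 <= k1 - i + j by lia.
apply: mini; exists rho.
have b0 : 0 < k1 - i + j by lia.
have b1 : k1 - i < k1 - i + j by lia.
rewrite /mch (_ : [set _ | _] = [set Ordinal b0; Ordinal b1]).
  by rewrite cards2 -val_eqE /= ltn_eqF ?subn_gt0.
apply/setP => p; rewrite !inE -!val_eqE /=.
apply/idP/orP => [M|].
  have pb := matches_at_bound j0 M.
  rewrite E // in M.
  case: (posnP p) => [->|p0]; [by left|right].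
  (* The choice of [k1] gives p >= k1 - i, and the length bound [pb] gives p <= k1 - i. *)
  have : k1 <= i + p by apply: min1; rewrite M andbT; lia.
  by move=> ?; apply/eqP; lia.
case=> /eqP->; rewrite E ?addn0 //; first by lia.
by rewrite subnKC // ltnW.
Qed.

(** The definition asks for at least one match of each pattern, so the factor spanning both windows
    serves directly. Only the minimality clause is assumed, so that the roles of the patterns can be
    exchanged; allowing [i = k] later shows that no position matches both. *)
Lemma mutual_sep_le n j (alpha beta : 'S_j) (s : 'S_n) i k :
  0 < j ->
  (forall m, (exists r : 'S_m, 1 <= mch alpha r /\ 1 <= mch beta r) ->
     2 * j - 1 <= m) ->
  matches_at alpha s i -> matches_at beta s k -> i <= k -> i + j.-1 <= k.
Proof.
move=> j0 mini Mi Mk le.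
have H : i + (k - i + j) <= n by have := matches_at_bound j0 Mk; lia.
have [rho E] := subpattern s H.
suff : 2 * j - 1 <= k - i + j by lia.
apply: mini; exists rho; split.
  by apply: (@mch_gt0 _ _ _ _ 0) => //; rewrite E ?addn0 //; lia.
by apply: (@mch_gt0 _ _ _ _ (k - i)) => //; rewrite E // subnKC.
Qed.

(** * Extending a permutation along an injection *)

Section ExtendPerm.

Variables (T U : finType) (w : T -> U).
Hypothesis winj : injective w.

Definition extend_fun (g : {perm T}) (x : U) : U :=
  if [pick k | w k == x] is Some k then w (g k) else x.

Lemma extend_fun_in g k : extend_fun g (w k) = w (g k).
Proof.
by rewrite /extend_fun; case: pickP => [l /eqP/winj->|/(_ k)] //; rewrite eqxx.
Qed.

Lemma extend_fun_out g x : x \notin codom w -> extend_fun g x = x.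
Proof.
by rewrite /extend_fun; case: pickP => // k /eqP<-; rewrite codom_f.
Qed.

Lemma extend_fun_inj g : injective (extend_fun g).
Proof.
apply: (can_inj (g := extend_fun g^-1)) => x.
case: (boolP (x \in codom w)) => [/codomP[k ->]|nx].
  by rewrite !extend_fun_in permK.
by rewrite !extend_fun_out.
Qed.

Definition extend_perm g : {perm U} := perm (@extend_fun_inj g).

Lemma extend_perm_in g k : extend_perm g (w k) = w (g k).
Proof. by rewrite permE extend_fun_in. Qed.

Lemma extend_perm_out g x : x \notin codom w -> extend_perm g x = x.
Proof. by rewrite permE; apply: extend_fun_out. Qed.

Lemma extend_permV g : extend_perm g^-1 = (extend_perm g)^-1%g.
Proof.
apply/esym/eqP; rewrite eq_invg_mul; apply/eqP/permP => x; rewrite permM perm1.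
case: (boolP (x \in codom w)) => [/codomP[k ->]|nx].
  by rewrite !extend_perm_in permK.
by rewrite !extend_perm_out.
Qed.

Lemma mem_extend_perm g x : (extend_perm g x \in codom w) = (x \in codom w).
Proof.
case: (boolP (x \in codom w)) => [/codomP[k ->]|nx].
  by rewrite extend_perm_in !codom_f.
by rewrite extend_perm_out // (negbTE nx).
Qed.

End ExtendPerm.

Lemma window_codom n i m (H : i + m <= n) (x : 'I_n) :
  (x \in codom (window H)) = (i <= x < i + m).
Proof.
apply/codomP/andP => [[k ->] /=|[ge lt]]; first by rewrite leq_addr ltn_add2l.
have km : x - i < m by lia.
by exists (Ordinal km); apply/val_inj; rewrite /= subnKC.
Qed.

(** * Descents and inversions as counts of pairs *)

(** A common form of des and inv, which lets one argument treat both under a rearrangement. *)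
Definition pair_stat (R : rel nat) n (s : 'S_n) : nat :=
  \sum_(x < n) \sum_(y < n) R x y && (s y < s x).

Lemma ninvE n (s : 'S_n) : ninv s = pair_stat ltn s.
Proof.
rewrite /ninv /pair_stat pair_big /= -sum1dep_card.
by rewrite [LHS]big_mkcond /=; apply: eq_bigr => p _; case: ifP.
Qed.

Lemma desE n (s : 'S_n) : des s = pair_stat (fun x y => y == x.+1) s.
Proof.
rewrite /des /pair_stat -sum1dep_card big_mkcond /=; apply: eq_bigr => x _.
case: existsP => [[y /andP[/eqP yx lt]]|H].
  rewrite (bigD1 y) //= yx eqxx lt big1 // => z nzy.
  by rewrite -yx val_eqE (negbTE nzy).
by rewrite big1 // => y _; apply/eqP; rewrite eqb0; apply/negP => B; apply: H; exists y.
Qed.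

(** * Rearranging a single window *)

Section Swap.

Variables (j : nat) (alpha beta : 'S_j) (n i : nat) (H : i + j <= n).

(** Products compose from left to right, so [swap_perm * s] puts at place k of the window the entry
    that stood where [alpha] has the value [beta k]. *)
Definition swap_perm : 'S_n := extend_perm (window_inj H) (beta * alpha^-1)%g.

Lemma swap_perm_window k :
  swap_perm (window H k) = window H (alpha^-1 (beta k))%g.
Proof. by rewrite extend_perm_in permM. Qed.

Lemma swap_perm_fix_window k : alpha k = beta k ->
  swap_perm (window H k) = window H k.
Proof. by move=> E; rewrite swap_perm_window -E permK. Qed.

Lemma swap_perm_out (x : 'I_n) : ~~ (i <= x < i + j) -> swap_perm x = x.
Proof. by rewrite -window_codom; apply: extend_perm_out. Qed.

Lemma mem_swap_perm (x : 'I_n) : (i <= swap_perm x < i + j) = (i <= x < i + j).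
Proof. by rewrite -!window_codom mem_extend_perm. Qed.

Lemma matches_at_swap (s : 'S_n) :
  matches_at alpha s i -> matches_at beta (swap_perm * s)%g i.
Proof.
rewrite !(matches_at_window H) => /order_isoP E; apply/order_isoP => k l.
by rewrite !permM !swap_perm_window E !permKV.
Qed.

(** Inside a matching window the order of the entries is that of [tau], and [R] is invariant under
    translation by [i]. *)
Lemma pair_stat_window R m (tau : 'S_m) (s : 'S_n) (Hm : i + m <= n) :
  (forall k l, R (i + k) (i + l) = R k l) -> matches_at tau s i ->
  \sum_(x < n | x \in codom (window Hm)) \sum_(y < n | y \in codom (window Hm))
    (R x y && (s y < s x) : nat) = pair_stat R tau.
Proof.
move=> shiftR; rewrite (matches_at_window Hm) => /order_isoP E.
have sumE (F : 'I_n -> nat) :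
    \sum_(x < n | x \in codom (window Hm)) F x = \sum_(k < m) F (window Hm k).
  rewrite -big_uniq /=; first by rewrite big_image.
  by rewrite map_inj_uniq ?enum_uniq //; exact: window_inj.
rewrite sumE; apply: eq_bigr => k _; rewrite sumE; apply: eq_bigr => l _.
by rewrite /= shiftR E.
Qed.

Lemma pair_stat_split R (s : 'S_n) (A : pred 'I_n) :
  pair_stat R s =
  \sum_(x < n | A x) \sum_(y < n | A y) (R x y && (s y < s x) : nat) +
  \sum_(x < n) \sum_(y < n | ~~ (A x && A y)) (R x y && (s y < s x) : nat).
Proof.
rewrite [X in X + _]big_mkcond -big_split; apply: eq_bigr => x _ /=.
by rewrite (bigID (fun y => A x && A y)) /=; case: (A x); rewrite //= big_pred0_eq.
Qed.

(* The hypothesis on [R] lets the pairs that are not both in the window be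
   reindexed along [swap_perm]. *)
Lemma pair_stat_swap (R : rel nat) (s : 'S_n) :
  (forall k l, R (i + k) (i + l) = R k l) ->
  (forall x y : 'I_n, ~~ ((i <= x < i + j) && (i <= y < i + j)) ->
     R (swap_perm x) (swap_perm y) = R x y) ->
  pair_stat R alpha = pair_stat R beta ->
  matches_at alpha s i -> pair_stat R (swap_perm * s)%g = pair_stat R s.
Proof.
move=> shiftR fixR eqR M.
have M' := matches_at_swap M.
rewrite (pair_stat_split R s (mem (codom (window H)))).
rewrite (pair_stat_split R (swap_perm * s) (mem (codom (window H)))).
rewrite (pair_stat_window H shiftR M) (pair_stat_window H shiftR M') eqR.
congr (_ + _).
rewrite [RHS](reindex_inj (@perm_inj _ swap_perm)); apply: eq_bigr => x _.
rewrite [RHS](reindex_inj (@perm_inj _ swap_perm)); apply: eq_big => y.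
  by rewrite !inE !window_codom !mem_swap_perm.
by rewrite !inE !window_codom => out; rewrite !permM fixR.
Qed.

Lemma ninv_swap (s : 'S_n) : ninv alpha = ninv beta ->
  matches_at alpha s i -> ninv (swap_perm * s)%g = ninv s.
Proof.
rewrite !ninvE => E; apply: pair_stat_swap => //= [k l|x y]; first by rewrite ltn_add2l.
(* The window is an interval preserved by [swap_perm], so an outside position lies on the same side
   of a window position and of its image. *)
have := mem_swap_perm x; have := mem_swap_perm y.
case: (boolP (i <= x < i + j)) => [ix|/swap_perm_out->].
  by case: (boolP (i <= y < i + j)) => // iy; rewrite (swap_perm_out iy); lia.
by case: (boolP (i <= y < i + j)) => [iy|/swap_perm_out->] //; lia.
Qed.

Variable a : 'I_j.
Hypothesis prefix : forall k : 'I_j, k <= a -> alpha k = beta k.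
Hypothesis last : forall k : 'I_j, k.+1 = j -> alpha k = beta k.

(** The fixed positions include the first [a + 1] of the window and, through the successor in
    [x.+1], its last one. *)
Lemma swap_perm_fix (x : 'I_n) :
  (x <= i + a) || (i + j <= x.+1) -> swap_perm x = x.
Proof.
move=> D; case: (boolP (x \in codom (window H))) => [/codomP[k xk]|]; last first.
  by rewrite window_codom; apply: swap_perm_out.
rewrite xk swap_perm_fix_window //.
case/orP: D; rewrite xk /= => D; first by apply: prefix; rewrite -(leq_add2l i).
by apply: last; have := ltn_ord k; lia.
Qed.

(** If exactly one of two adjacent positions lies in the window, it is an end of the window, hence
    fixed. *)
Lemma des_swap (s : 'S_n) : des alpha = des beta ->
  matches_at alpha s i -> des (swap_perm * s)%g = des s.
Proof.
rewrite !desE => E; apply: pair_stat_swap => //= [k l|x y].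
  by rewrite -addnS eqn_add2l.
have mem_x := mem_swap_perm x; have mem_y := mem_swap_perm y.
have fix_end (z : 'I_n) : (z <= i) || (i + j <= z.+1) -> swap_perm z = z.
  by move=> D; apply: swap_perm_fix; lia.
(* The same with the condition on the image: [fix_end] fixes that image, and injectivity then fixes
   [z]. *)
have fix_end' (z : 'I_n) :
    (swap_perm z <= i) || (i + j <= (swap_perm z).+1) -> swap_perm z = z.
  by move=> /fix_end/perm_inj.
case: (boolP (i <= x < i + j)) mem_x => [ix|/swap_perm_out->] mem_x.
  case: (boolP (i <= y < i + j)) => // iy; rewrite (swap_perm_out iy) => _.
  apply/eqP/eqP => E'; last by rewrite (fix_end x); lia.
  have fix_x : swap_perm x = x by apply: fix_end'; lia.
  by rewrite E' fix_x.
case: (boolP (i <= y < i + j)) mem_y => [iy|/swap_perm_out->] // mem_y _.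
apply/eqP/eqP => E'; last by rewrite (fix_end y); lia.
have fix_y : swap_perm y = y by apply: fix_end'; lia.
by rewrite -E' fix_y.
Qed.

(** The inequalities let the other window meet the rearranged one in at most one end, so [swap_perm]
    fixes all its positions. *)
Lemma matches_at_swap_far k m (tau : 'S_m) (s : 'S_n) :
  (k + m <= i.+1) || (i + j <= k.+1) ->
  matches_at tau (swap_perm * s)%g k = matches_at tau s k.
Proof.
move=> far.
case: (posnP m) => [m0|m0].
  by subst m; rewrite /matches_at !take0.
have [Hk|Hk] := leqP (k + m) n; last first.
  by apply/idP/idP => /(matches_at_bound m0); lia.
rewrite !(matches_at_window Hk).
apply: eq_forallb => x; apply: eq_forallb => y; rewrite !permM.
by rewrite !swap_perm_fix //=; have := ltn_ord x; have := ltn_ord y; lia.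
Qed.

Hypothesis alpha_a : alpha a = 0 :> nat.
Hypothesis beta_a : beta a = 0 :> nat.

Lemma LRmin_swap (s : 'S_n) :
  matches_at alpha s i -> LRmin (swap_perm * s)%g = LRmin s.
Proof.
move=> M; have M' := matches_at_swap M.
(* After place [a] of the window, the smaller entry at that place rules out any left-to-right
   minimum. *)
have min_a (t : 'S_n) (tau : 'S_j) (x : 'I_n) :
    matches_at tau t i -> tau a = 0 :> nat -> i + a < x < i + j ->
    [forall y : 'I_n, (y < x) ==> (t x < t y)] = false.
  rewrite (matches_at_window H) => /order_isoP E ta lt.
  apply/negbTE/forallPn; exists (window H a); rewrite negb_imply /=.
  have /codomP[k xk] : x \in codom (window H) by rewrite window_codom; lia.
  by rewrite xk E ta ltn0 andbT; move: lt; rewrite xk /=; lia.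
rewrite /LRmin; congr #|pred_of_set _|; apply/setP => x; rewrite !inE.
case: (boolP (i + a < x < i + j)) => [in_x|out_x].
  by rewrite (min_a _ _ _ M alpha_a in_x) (min_a _ _ _ M' beta_a in_x).
have fix_x : swap_perm x = x by apply: swap_perm_fix; lia.
(* The window positions after place [a] are permuted among themselves, and [x] is not one of them,
   so the set of positions before [x] is preserved. *)
have below y : (swap_perm y < x) = (y < x).
  case: (boolP (y <= i + a)) => le; first by rewrite swap_perm_fix ?le.
  have gt : i + a < swap_perm y.
    rewrite ltnNge; apply: contra le => le.
    have fix_y : swap_perm y = y.
      by apply/(@perm_inj _ swap_perm)/swap_perm_fix; rewrite le.
    by rewrite -fix_y.
  have := mem_swap_perm y.
  by case: (boolP (i <= y < i + j)) => [|/swap_perm_out->]; lia.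
apply/forallP/forallP => C y; last first.
  by rewrite !permM fix_x -below; apply: C.
by have := C (swap_perm^-1 y)%g; rewrite -below !permM fix_x permKV.
Qed.

End Swap.

(** * Exchanging the matches at all positions *)

Section Exchange.

Variables (j : nat) (alpha beta : 'S_j) (a : 'I_j).
Hypothesis prefix : forall k : 'I_j, k <= a -> alpha k = beta k.
Hypothesis alpha_a : alpha a = 0 :> nat.
Hypothesis beta_a : beta a = 0 :> nat.
Hypothesis last : forall k : 'I_j, k.+1 = j -> alpha k = beta k.
Hypothesis eq_des : des alpha = des beta.
Hypothesis disjoint : forall n (s : 'S_n) i k,
  matches_at alpha s i || matches_at beta s i ->
  matches_at alpha s k || matches_at beta s k -> i < k -> i + j.-1 <= k.
Hypothesis distinct : forall n (s : 'S_n) i,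
  ~~ (matches_at alpha s i && matches_at beta s i).

(** The clause on inv is conditional so that one bijection serves both halves of the theorem. *)
Definition same_stats n (s t : 'S_n) : Prop :=
  [/\ des s = des t, LRmin s = LRmin t & ninv alpha = ninv beta -> ninv s = ninv t].

Lemma swap_perm_sym n i (H : i + j <= n) :
  swap_perm beta alpha H = (swap_perm alpha beta H)^-1%g.
Proof. by rewrite -extend_permV invMg invgK. Qed.

(** The map rearranges the window at [i] if it matches either pattern and is the identity otherwise.
    The rearrangements in the two directions are inverse to each other. *)
Lemma exchange_at n i : exists g : 'S_n -> 'S_n,
  [/\ involutive g, forall s, same_stats (g s) s,
      forall s k, matches_at alpha (g s) k =
        (if k == i then matches_at beta s k else matches_at alpha s k) &
      forall s k, matches_at beta (g s) k =
        (if k == i then matches_at alpha s k else matches_at beta s k)].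
Proof.
have j0 : 0 < j := leq_ltn_trans (leq0n a) (ltn_ord a).
have [H|H] := leqP (i + j) n; last first.
  have no (tau : 'S_j) (s : 'S_n) : matches_at tau s i = false.
    by apply/negP => /(matches_at_bound j0); lia.
  by exists id; split => // s k; case: eqP => [->|]; rewrite ?no.
have prefix' (k : 'I_j) : k <= a -> beta k = alpha k by move/prefix->.
have last' (k : 'I_j) : k.+1 = j -> beta k = alpha k by move/last->.
pose p := swap_perm alpha beta H; pose p' := swap_perm beta alpha H.
pose g (s : 'S_n) : 'S_n := if matches_at alpha s i then (p * s)%g
  else if matches_at beta s i then (p' * s)%g else s.
have gA (s : 'S_n) : matches_at alpha s i -> g s = (p * s)%g by rewrite /g => ->.
have gB (s : 'S_n) : matches_at beta s i -> g s = (p' * s)%g.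
  by move=> MB; rewrite /g MB; have := distinct s i; rewrite MB andbT => /negbTE->.
have far (s : 'S_n) k (tau : 'S_j) : matches_at alpha s i || matches_at beta s i ->
    (tau == alpha) || (tau == beta) -> matches_at tau s k -> k != i ->
    (k + j <= i.+1) || (i + j <= k.+1).
  move=> Mi Dtau Mk; have {Dtau}Mk : matches_at alpha s k || matches_at beta s k.
    by case/orP: Dtau => /eqP E; rewrite -E Mk ?orbT.
  rewrite neq_ltn => /orP[] lt.
    by have := disjoint Mk Mi lt; lia.
  by have := disjoint Mi Mk lt; lia.
have off (s : 'S_n) k (tau : 'S_j) : (tau == alpha) || (tau == beta) -> k != i ->
    matches_at tau (g s) k = matches_at tau s k.
  move=> Dtau ki; case: (boolP (matches_at alpha s i)) => [MA|nA].
    have MB := matches_at_swap beta H MA.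
    have eqM := matches_at_swap_far H prefix last tau s (k := k).
    (* The distance from [k] to [i] comes from whichever side is assumed to match at [k]; position
       [i] matches one of the patterns both before and after the rearrangement. *)
    rewrite gA //; apply/idP/idP => M; last first.
      by rewrite eqM // (far s k tau) ?MA.
    by rewrite -eqM // (far (p * s)%g k tau) ?MB ?orbT.
  case: (boolP (matches_at beta s i)) => [MB|nB]; last first.
    by rewrite /g (negbTE nA) (negbTE nB).
  have MA := matches_at_swap alpha H MB.
  have eqM := matches_at_swap_far H prefix' last' tau s (k := k).
  rewrite gB //; apply/idP/idP => M; last first.
    by rewrite eqM // (far s k tau) ?MB ?orbT.
  by rewrite -eqM // (far (p' * s)%g k tau) ?MA.
have on (s : 'S_n) : matches_at alpha (g s) i = matches_at beta s i /\
    matches_at beta (g s) i = matches_at alpha s i.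
  have exclA (t : 'S_n) : matches_at alpha t i -> matches_at beta t i = false.
    by move=> MA; have := distinct t i; rewrite MA => /negbTE.
  have exclB (t : 'S_n) : matches_at beta t i -> matches_at alpha t i = false.
    by move=> MB; have := distinct t i; rewrite MB andbT => /negbTE.
  case: (boolP (matches_at alpha s i)) => [MA|nA].
    have MB := matches_at_swap beta H MA.
    by rewrite gA // MB (exclA _ MA) (exclB _ MB).
  case: (boolP (matches_at beta s i)) => [MB|nB].
    have MA := matches_at_swap alpha H MB.
    by rewrite gB // MA (exclA _ MA).
  by rewrite /g (negbTE nA) (negbTE nB) (negbTE nA) (negbTE nB).
exists g; split.
- move=> s; have [onA onB] := on s.
  case: (boolP (matches_at alpha s i)) => [MA|nA].
    by rewrite gB ?onB // gA // mulgA /p' swap_perm_sym mulVg mul1g.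
  case: (boolP (matches_at beta s i)) => [MB|nB].
    by rewrite gA ?onA // gB // mulgA /p' swap_perm_sym mulgV mul1g.
  by rewrite {1}/g onA onB (negbTE nA) (negbTE nB) /g (negbTE nA) (negbTE nB).
- move=> s; case: (boolP (matches_at alpha s i)) => [MA|nA].
    rewrite gA //; split; [exact: (des_swap H prefix last eq_des MA)| |].
      exact: (LRmin_swap H prefix last alpha_a beta_a MA).
    by move=> E; apply: ninv_swap.
  case: (boolP (matches_at beta s i)) => [MB|nB].
    rewrite gB //; split; [exact: (des_swap H prefix' last' (esym eq_des) MB)| |].
      exact: (LRmin_swap H prefix' last' beta_a alpha_a MB).
    by move=> E; apply: ninv_swap.
  by rewrite /g (negbTE nA) (negbTE nB).
- by move=> s k; case: eqVneq => [->|ki]; [case: (on s)|rewrite off ?eqxx].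
- by move=> s k; case: eqVneq => [->|ki]; [case: (on s)|rewrite off ?eqxx ?orbT].
Qed.

(** Induction composes the exchanges at single positions; each leaves the matches at all other
    positions alone. A composite of involutions is still injective, which is all a reindexing of a
    finite sum requires. *)
Lemma exchange_below n m : exists g : 'S_n -> 'S_n,
  [/\ injective g, forall s, same_stats (g s) s,
      forall s k, matches_at alpha (g s) k =
        (if k < m then matches_at beta s k else matches_at alpha s k) &
      forall s k, matches_at beta (g s) k =
        (if k < m then matches_at alpha s k else matches_at beta s k)].
Proof.
elim: m => [|m [g [injg statg gA gB]]]; first by exists id; split=> // s.
have [h [hK stath hA hB]] := exchange_at n m.
exists (h \o g); split.
- exact: inj_comp (inv_inj hK) injg.
- move=> s; have [d1 l1 i1] := statg s; have [d2 l2 i2] := stath (g s).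
  by split=> [||E]; rewrite /= ?d2 ?l2 ?i2 ?d1 ?l1 ?i1.
- by move=> s k; rewrite /= hA gA gB ltnS; case: (ltngtP k m).
- by move=> s k; rewrite /= hB gA gB ltnS; case: (ltngtP k m).
Qed.

Lemma NM_exchange n : exists g : 'S_n -> 'S_n,
  [/\ injective g, forall s, same_stats (g s) s &
      forall s, (g s \in NM n beta) = (s \in NM n alpha)].
Proof.
(* With [m = n] every position that [mch] counts has been exchanged. *)
have [g [injg statg gA gB]] := exchange_below n n.
exists g; split=> // s; rewrite !inE /mch.
by congr (#|pred_of_set _| == 0); apply/setP => k; rewrite !inE gB ltn_ord.
Qed.

(* The hypothesis on [F] covers both an [F] that ignores inv and any [F] when
   alpha and beta have the same inv. *)
Lemma sum_NM (R : nmodType) (F : nat -> nat -> nat -> R) n :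
  (forall d l i i', (ninv alpha = ninv beta -> i = i') -> F d i l = F d i' l) ->
  (\sum_(s in NM n alpha) F (des s) (ninv s) (LRmin s) =
   \sum_(s in NM n beta) F (des s) (ninv s) (LRmin s))%R.
Proof.
move=> eqF; have [g [injg statg gNM]] := NM_exchange n.
rewrite [RHS](reindex_inj injg); apply: eq_big => s; first by rewrite gNM.
by case: (statg s) => -> -> E _; apply: eqF => E'; rewrite E.
Qed.

End Exchange.

Theorem theorem1p7 (j : nat) (hj : 3 <= j) (alpha beta : 'S_j)
    (hmmo : mutually_minimal_overlapping alpha beta)
    (a : 'I_j) (ha : a.+1 < j)
    (hprefix : forall i : 'I_j, i <= a -> alpha i = beta i)
    (halpha_a : alpha a = 0 :> nat) (hbeta_a : beta a = 0 :> nat)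
    (hlast : forall i : 'I_j, i.+1 = j -> alpha i = beta i)
    (hdes : des alpha = des beta) :
  (egf_des_LRmin alpha =1 egf_des_LRmin beta
   /\ c_Wilf_equivalent [tuple @des; @LRmin] alpha beta)
  /\ (ninv alpha = ninv beta ->
      qegf_des_inv_LRmin alpha =1 qegf_des_inv_LRmin beta
      /\ c_Wilf_equivalent [tuple @des; @ninv; @LRmin] alpha beta).
Proof.
have j0 : 0 < j by lia.
case: hmmo => moA moB [_ mini].
have mini' m : (exists r : 'S_m, 1 <= mch beta r /\ 1 <= mch alpha r) -> 2 * j - 1 <= m.
  by case=> r [? ?]; apply: mini; exists r.
have disjoint n (s : 'S_n) i k :
  matches_at alpha s i || matches_at beta s i ->
  matches_at alpha s k || matches_at beta s k -> i < k -> i + j.-1 <= k.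
  move=> /orP[] Mi /orP[] Mk lt.
  - exact: minimal_overlapping_sep moA Mi Mk lt.
  - exact: mutual_sep_le mini Mi Mk (ltnW lt).
  - exact: mutual_sep_le mini' Mi Mk (ltnW lt).
  - exact: minimal_overlapping_sep moB Mi Mk lt.
have distinct n (s : 'S_n) i : ~~ (matches_at alpha s i && matches_at beta s i).
  (* A common match would be at distance 0 from itself, but the distance is at least [j.-1 > 0]. *)
  by apply/andP => -[MA MB]; have := mutual_sep_le j0 mini MA MB (leqnn i); lia.
have sums := sum_NM hprefix halpha_a hbeta_a hlast hdes disjoint distinct.
(* A summand that ignores inv meets the condition of [sum_NM] trivially; in [sum3] the equality of
   the inversion numbers provides it. *)
have sum2 R F n := sums R (fun d i l => F d l) n (fun _ _ _ _ _ => erefl).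
split; first split.
- by move=> n; rewrite /egf_des_LRmin (sum2 _ (fun d l => 'X_0 ^+ d * 'X_1 ^+ l)%R).
- move=> n; under eq_bigr do rewrite !big_ord_recl big_ord0 GRing.mulr1.
  under [RHS]eq_bigr do rewrite !big_ord_recl big_ord0 GRing.mulr1.
  (* Unrolling the product with [big_ord_recl] yields the index 1 in the form [lift ord0 ord0]. *)
  exact: (sum2 _ (fun d l => 'X_ord0 ^+ d * 'X_(lift ord0 ord0) ^+ l)%R).
move=> eqi.
have sum3 R F n := sums R F n (fun d l i i' E => congr1 (F d ^~ l) (E eqi)).
split.
- move=> n; rewrite /qegf_des_inv_LRmin.
  by rewrite (sum3 _ (fun d i l => 'X_0 ^+ d * 'X_1 ^+ i * 'X_(2%R) ^+ l)%R).
- move=> n; under eq_bigr do rewrite !big_ord_recl big_ord0 GRing.mulr1.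
  under [RHS]eq_bigr do rewrite !big_ord_recl big_ord0 GRing.mulr1.
  apply: (sum3 _ (fun d i l => 'X_ord0 ^+ d * ('X_(lift ord0 ord0) ^+ i *
    'X_(lift ord0 (lift ord0 ord0)) ^+ l))%R).
Qed.
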